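(* Let $m\ge 1$ and let $P$ be a fairy chess piece with move set $A_P\subseteq\mathbb{Z}^2$ as described in the context, and let $q_1,\dots,q_m\ge 0$ be integers (with all $q_j\le 1$ if the horizontal moves of $P$ are all of $\mathbb{Z}\times\{0\}$); put $q=q_1+\cdots+q_m$. Then the number $\nu_m(n)$ of nonattacking configurations having exactly $q_j$ pieces in row $j$ for each $j\in[m]$ is, as a function of the integer $n\ge 0$, a piecewise polynomial of degree $q$ with leading coefficient $(q_1!q_2!\cdots q_m!)^{-1}$, and it agrees with a single polynomial for all sufficiently large $n$. A sufficient condition for $n$ to be sufficiently large is $$n\ \ge\ (q-1)\cdot \max\{\,|\mu| : (\mu,k)\in A_P,\ 0\le k<m\,\},$$ where, if $P$ has unbounded horizontal moves or if all $q_j\le 1$, the maximum is instead taken over $1\le k<m$.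
   Context: A fairy chess piece $P$ is given by a set of moves $A_P\subseteq\mathbb{Z}^2$ (first coordinate = horizontal/column displacement, second coordinate = vertical/row displacement) such that: $A_P$ is centrally symmetric ($A_P=-A_P$); for each nonzero integer $k$ only finitely many $(\mu,k)$ lie in $A_P$; and the set of horizontal moves $\{(h,0)\in A_P\}$ is either finite or equal to $\mathbb{Z}\times\{0\}$. A piece at $(j,k)$ attacks the squares $(j,k)+A_P$. The board has $m$ rows and $n$ columns, $[n]\times[m]$, where $[n]=\{1,\dots,n\}$. A labelled configuration with $q_j$ pieces in row $j$ is a vector $x=(x_j^r)_{j\in[m],\,r\in[q_j]}\in[n]^q$, $x_j^r$ being the column of the $r$th piece in row $j$. It is nonattacking if (N1) for all $1\le i<j\le m$, $r\in[q_i]$, $s\in[q_j]$: $(x_j^s-x_i^r,\,j-i)\notin A_P$; and (N2) for all $j\in[m]$ and $r<s$ in $[q_j]$: $(x_j^s-x_j^r,\,0)\notin A_P$. If $\lambda_m(n)$ denotes the number of nonattacking labelled configurations, the number of nonattacking configurations is $\nu_m(n):=\lambda_m(n)/(q_1!\cdots q_m!)$. A function $f$ on the nonnegative integers is a piecewise polynomial of degree $q$ with leading coefficient $c$ if the nonnegative integers can be partitioned into finitely many intervals on each of which $f$ agrees with a polynomial of degree $q$ with leading coefficient $c$. *)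

(* Defs.v *)
From mathcomp Require Import all_boot all_order all_algebra.
From mathcomp Require Import all_classical.

Set Implicit Arguments.
Unset Strict Implicit.
Unset Printing Implicit Defensive.

Import Order.TTheory GRing.Theory Num.Theory.

Local Open Scope classical_set_scope.
Local Open Scope ring_scope.

Definition horizontal_line : set (int * int) := setT `*` [set 0].

(* The first coordinate is the column displacement, the second the row
   displacement. *)
Record fairy_piece := FairyPiece {
  moves :> set (int * int);
  moves_sym : moves = [set - u | u in moves];
  moves_finite : forall k : int, k != 0 -> finite_set [set mu | moves (mu, k)];
  moves_horizontal : finite_set (moves `&` horizontal_line) \/
                     moves `&` horizontal_line = horizontal_line
}.

Definition horizontally_unbounded (P : fairy_piece) : Prop :=
  moves P `&` horizontal_line = horizontal_line.

Section Configurations.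
Variables (m : nat) (q : 'I_m -> nat).

(* x (Tagged _ r), for r : 'I_(q j), is the column of the r-th piece in row j.
   Rows, columns and pieces are numbered from 0 rather than from 1; only
   differences of row and of column numbers matter below. *)
Definition labelled_config (n : nat) : finType :=
  {ffun {j : 'I_m & 'I_(q j)} -> 'I_n}.

Definition column n (x : labelled_config n) (j : 'I_m) (r : 'I_(q j)) : int :=
  (x (Tagged (fun j => 'I_(q j)) r))%:Z.

Definition nonattacking (P : fairy_piece) n (x : labelled_config n) : Prop :=
  (forall (i j : 'I_m) (r : 'I_(q i)) (s : 'I_(q j)), (i < j)%N ->
     ~ moves P (column x s - column x r, j%:Z - i%:Z)) /\
  (forall (j : 'I_m) (r s : 'I_(q j)), (r < s)%N ->
     ~ moves P (column x s - column x r, 0)).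

Definition num_labelled (P : fairy_piece) (n : nat) : nat :=
  #|[pred x : labelled_config n | `[< nonattacking P x >]]|.

Definition num_nonattacking (P : fairy_piece) (n : nat) : rat :=
  (num_labelled P n)%:R / (\prod_(j < m) (q j)`!)%:R.

End Configurations.

(* max {|mu| : (mu, k) \in A_P, lo <= k < hi}, the maximum of the empty set
   being 0.  The big operator ranges over a finite set unless lo = 0 < hi and P
   is horizontally unbounded. *)
Definition max_displacement (P : fairy_piece) (lo hi : nat) : nat :=
  \big[maxn/0%N]_(mu \in [set mu : int | exists2 k : nat,
                           (lo <= k < hi)%N & moves P (mu, k%:Z)]) `|mu|%N.

Definition has_degree_lead (d : nat) (c : rat) (p : {poly rat}) : Prop :=
  size p = d.+1 /\ lead_coef p = c.

Definition piecewise_polynomial (d : nat) (c : rat) (f : nat -> rat) : Prop :=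
  exists (k : nat) (I : 'I_k -> interval nat),
    partition setT (fun i => [set` I i]) setT /\
    forall i, exists2 p : {poly rat}, has_degree_lead d c p &
      forall n : nat, n \in I i -> f n = p.[n%:R].

(* Main.v *)
(* Forbid finitely many equations x_v - x_u = d, one for each pair of pieces
   u, v and each move d joining their rows.  Deleting a forbidden equation, and
   subtracting the configurations that satisfy it, reduces the count to systems
   S of equations alone.  If S has an integer solution z, then its solutions are
   the translates of z along each connected component of the graph of S, so the
   number of solutions in [0, n) is the product over the components of
   n - (width of z on the component).  A simple path has fewer than q edges,
   hence the widths are at most (q - 1) M, and this formula is valid as soon as
   n >= (q - 1) M.  A nonempty S has fewer than q components, so the leading
   term n ^ q comes from the empty system. *)

Require Import Defs.
From mathcomp Require Import all_boot all_order all_algebra.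
From mathcomp Require Import all_classical.
From mathcomp Require Import zify.

Set Implicit Arguments.
Unset Strict Implicit.
Unset Printing Implicit Defensive.

Import Order.TTheory GRing.Theory Num.Theory.

Local Open Scope classical_set_scope.
Local Open Scope ring_scope.

(** * Systems of difference equations and their graphs *)

Lemma card_ord_window (n a b : nat) : (a + b <= n)%N ->
  #|[pred k : 'I_n | (a <= k)%N && (k < n - b)%N]| = (n - (a + b))%N.
Proof.
move=> abn; rewrite -sum1_card.
rewrite -(big_mkord (fun k => (a <= k)%N && (k < n - b)%N) (fun=> 1%N)).
rewrite -big_nat_widen; last by lia.
rewrite (eq_bigl (fun k => true && (a <= k)%N)) //.
by rewrite -big_nat_widenl // sum_nat_const_nat; lia.
Qed.

(* A constraint [(u, v, d)] stands for the equation [x v - x u = d]. *)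
Definition satisfies {T : finType} (x : T -> int) (c : T * T * int) : bool :=
  x c.1.2 - x c.1.1 == c.2.

Definition constraint_graph {T : finType} (S : seq (T * T * int)) : rel T :=
  fun u v => has (fun c => (c.1 == (u, v)) || (c.1 == (v, u))) S.

(** Distinct ends ensure that a nonempty system has fewer components than variables; [M] bounds the
    length of an edge. *)
Definition bounded_constraint {T : finType} (M : nat) (c : T * T * int) : bool :=
  (c.1.1 != c.1.2) && (`|c.2| <= M)%N.

(** [C] lists the equations that must fail, [S] those that must hold. Deletion moves an equation
    from [C] to [S]. *)
Definition num_solutions {T : finType} (C S : seq (T * T * int)) (n : nat) :=
  #|[pred x : {ffun T -> 'I_n} |
      all (fun c => ~~ satisfies (fun t => (x t)%:Z) c) C &&
      all (satisfies (fun t => (x t)%:Z)) S]|.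

Section ConstraintGraph.
Variable T : finType.
Implicit Types (S C : seq (T * T * int)) (x z : T -> int) (M n : nat).

Lemma constraint_graph_sym S : connect_sym (constraint_graph S).
Proof.
by apply: sym_connect_sym => u v; apply: eq_has => c; rewrite orbC.
Qed.

Lemma constraint_edgeP S x u v : all (satisfies x) S -> constraint_graph S u v ->
  exists2 c, c \in S & (x v - x u = c.2) \/ (x v - x u = - c.2).
Proof.
move=> /allP xS /hasP[c cS cuv]; exists c => //.
have /eqP <- := xS c cS.
by case/orP: cuv => /eqP -> /=; [left | right; rewrite opprB].
Qed.

(** Each edge of a path comes from an equation that fixes the same difference for [x] and [z]; these
    differences telescope. *)
Lemma satisfies_connect S z x u v : all (satisfies z) S -> all (satisfies x) S ->
  connect (constraint_graph S) u v -> x v - x u = z v - z u.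
Proof.
move=> zS xS /connectP[p + ->]; elim: p u => [u _|w p IH u] /=.
  by rewrite !subrr.
case/andP => /hasP[c cS cuw] /IH.
have /eqP := allP zS c cS; have /eqP := allP xS c cS.
by case/orP: cuw => /eqP -> /=; lia.
Qed.

Lemma connect_satisfies S z x : all (satisfies z) S ->
  (forall u v, connect (constraint_graph S) u v -> x v - x u = z v - z u) ->
  all (satisfies x) S.
Proof.
move=> /allP zS xz; apply/allP => c cS; have /eqP zc := zS c cS.
rewrite /satisfies xz ?zc //; apply: connect1; apply/hasP; exists c => //.
by rewrite -surjective_pairing eqxx.
Qed.

Lemma component_width S M z u v : all (bounded_constraint M) S ->
  all (satisfies z) S -> connect (constraint_graph S) u v ->
  (`|z v - z u| <= #|T|.-1 * M)%N.
Proof.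
move=> SM zS /connectP[p0 /shortenP[p ep up _] ->].
have sp : (size p <= #|T|.-1)%N.
  by have := max_card (mem (u :: p)); rewrite (card_uniqP up) /=; lia.
suff /leq_trans : (`|z (last u p) - z u| <= size p * M)%N.
  by apply; rewrite leq_mul2r sp orbT.
elim: p {sp up} u ep => [|w p IH] u /=; first by rewrite subrr.
case/andP => /(constraint_edgeP zS)[[[a b] d] cS /= zc] /IH.
have /andP[_ /=] := allP SM _ cS; rewrite mulSn.
by move: (size p * M)%N => s; case: zc; lia.
Qed.

(** The two ends of an equation of [S] are distinct but connected, hence share a root, so one of
    them is not a root. *)
Lemma num_constraint_roots S M : all (bounded_constraint M) S -> S != [::] ->
  (#|{: {r : T | roots (constraint_graph S) r}}| < #|T|)%N.
Proof.
case: S => // c S SM _; set e := constraint_graph _.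
have euv : connect e c.1.1 c.1.2.
  by apply: connect1; rewrite /e /constraint_graph /= -surjective_pairing eqxx.
rewrite card_sig -[X in (_ < X)%N](cardC (roots e)).
rewrite -[ltnLHS]addn0 (_ : #|[pred x | roots e x]| = #|roots e|);
  last exact: eq_card.
rewrite ltn_add2l; apply/card_gt0P.
have sym := constraint_graph_sym (c :: S).
case ru : (roots e c.1.1); last by exists c.1.1; rewrite inE /= /in_mem /= ru.
exists c.1.2; rewrite inE /= /in_mem /=; apply/negP => rv.
have := root_connect sym c.1.1 c.1.2; rewrite -/e euv.
move: ru rv; rewrite /roots /= => /eqP -> /eqP ->.
by move: SM => /= /andP[/andP[/negPf ->]].
Qed.

(** * Solutions of a solvable system, component by component *)

Section Solutions.
Variables (S : seq (T * T * int)) (z : T -> int).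
Hypothesis zS : all (satisfies z) S.
Let e := constraint_graph S.
Let root_type := {r : T | roots e r}.

(** Columns of the root [r] for which the translate of [z] on its whole component fits into
    [[0, n)]. *)
Definition root_window n (r : root_type) : pred 'I_n :=
  [pred k : 'I_n | [forall t, connect e (val r) t ==>
                     (0 <= k%:Z + z t - z (val r) < n%:Z)]].

Arguments root_window : clear implicits.

Lemma num_solutions_root_window n :
  num_solutions [::] S n = (\prod_(r : root_type) #|root_window n r|)%N.
Proof.
(* [res] keeps the columns of the component roots only. It is injective on solutions, because [z]
   determines all other columns from these, and its image is the family of root windows. *)
pose res (x : {ffun T -> 'I_n}) : {ffun root_type -> 'I_n} :=
  [ffun r => x (val r)].
pose D := [pred x : {ffun T -> 'I_n} | all (satisfies (fun t => (x t)%:Z)) S].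
have sym : connect_sym e := constraint_graph_sym S.
pose rt t : root_type :=
  exist (fun r => roots e r) (fingraph.root e t) (roots_root sym t).
have DE (x : {ffun T -> 'I_n}) t : D x ->
    (x t)%:Z = (x (fingraph.root e t))%:Z + z t - z (fingraph.root e t).
  move=> xD; have := satisfies_connect zS xD (connect_root e t).
  by rewrite /=; lia.
have res_inj : {in D &, injective res}.
  move=> x y xD yD /ffunP xy; apply/ffunP => t; apply/val_inj/eqP => /=.
  have := xy (rt t); rewrite !ffunE /= => rxy.
  by rewrite -eqz_nat (DE x) // (DE y) // rxy.
rewrite /num_solutions -[LHS](card_in_imset res_inj).
have -> : \prod_(r : root_type) #|root_window n r|%N =
    #|family (root_window n)|.
  rewrite card_family /image_mem foldrE big_map big_enum /=.
  by apply: eq_bigr => r _.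
apply: eq_card => y; apply/imsetP/familyP => [[x xD ->] r|yF].
  rewrite inE ffunE; apply/forallP => t; apply/implyP => ert.
  have := satisfies_connect zS xD ert; have := ltn_ord (x t); rewrite /=; lia.
(* Conversely, root columns [y] prescribe the column of each [t] by translating [z]; the window
   condition puts it in [[0, n)]. *)
have ex t : exists k : 'I_n, k%:Z ==
    (y (rt t))%:Z + z t - z (fingraph.root e t).
  have := yF (rt t); rewrite inE.
  move=> /forallP/(_ t); rewrite /= sym connect_root /= => /andP[k0 kn].
  set k := (k in 0 <= k) in k0 kn.
  have kn' : (`|k| < n)%N by lia.
  by exists (Ordinal kn'); apply/eqP => /=; lia.
pose x : {ffun T -> 'I_n} := [ffun t => xchoose (ex t)].
have xE t : (x t)%:Z =
    (y (rt t))%:Z + z t - z (fingraph.root e t).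
  by rewrite ffunE; exact/eqP/(xchooseP (ex t)).
exists x.
  rewrite inE; apply: (connect_satisfies zS) => u v euv.
  rewrite !xE.
  have /eqP ruv : fingraph.root e u == fingraph.root e v by rewrite root_connect.
  have -> : rt u = rt v by exact/val_inj.
  by rewrite ruv; lia.
apply/ffunP => -[r rr]; rewrite ffunE /=.
have rrE : fingraph.root e r = r by apply/eqP.
apply/val_inj/eqP; rewrite /= -eqz_nat xE rrE addrK; apply/eqP.
congr (Posz (nat_of_ord (y _))).
by apply/val_inj; rewrite /= rrE.
Qed.

Lemma card_root_window M (r : root_type) : all (bounded_constraint M) S ->
  exists w : nat, forall n, (#|T|.-1 * M <= n)%N ->
    #|root_window n r|%:R = (n%:R - w%:R : rat).
Proof.
move=> SM; have err := connect0 e (val r).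
have [t1 ert1 t1min] := arg_minP z err.
have [t2 ert2 t2max'] := arg_maxP z err.
have t2max t : connect e (val r) t -> z t <= z t2 by move=> /t2max'.
have ert12 : connect e t1 t2.
  by apply: connect_trans ert2; rewrite constraint_graph_sym.
have wM := component_width SM zS ert12.
(* [z] is least at [t1] and greatest at [t2], so the root needs [a] columns to its left and [b] to
   its right. The width [a + b] is at most the threshold, so [n - (a + b)] does not truncate. *)
pose a := `|z (val r) - z t1|%N; pose b := `|z t2 - z (val r)|%N.
have z1 := t1min _ err; have z2 := t2max _ err.
exists (a + b)%N => n nM; rewrite -natrB; last by lia.
rewrite -card_ord_window; last by lia.
congr (_%:R); apply: eq_card => k; rewrite !inE.
apply/forallP/andP => [k_ok|[ak kb] t].
  have /implyP/(_ ert1) := k_ok t1; have /implyP/(_ ert2) := k_ok t2.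
  by lia.
apply/implyP => ert; have := t1min _ ert; have := t2max _ ert; lia.
Qed.

End Solutions.

(** * Polynomial counts by deleting forbidden equations *)

Lemma num_solutions_eqs_poly M S : all (bounded_constraint M) S -> S != [::] ->
  exists2 p : {poly rat}, (size p <= #|T|)%N &
    forall n, (#|T|.-1 * M <= n)%N -> (num_solutions [::] S n)%:R = p.[n%:R].
Proof.
move=> SM S0; have [[z zS]|noz] := pselect (exists z, all (satisfies z) S).
  have /boolp.choice[w wE] := fun r => card_root_window zS r SM.
  exists (\prod_r ('X - (w r)%:R%:P)).
    (* The size is one more than the number of components, so the bound says that there are fewer
       components than variables. *)
    rewrite size_prod_XsubC [index_enum _]unlock -enumT -cardE.
    exact: num_constraint_roots SM S0.
  move=> n nM; rewrite (num_solutions_root_window zS) natr_prod horner_prod.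
  by apply: eq_bigr => r _; rewrite !hornerE wE.
exists 0 => [|n _]; first by rewrite size_poly0.
rewrite horner0 /num_solutions eq_card0 // => x; rewrite !inE /=.
by apply/negP => xS; apply: noz; exists (fun t => (x t)%:Z).
Qed.

Lemma num_solutions_split c C S n :
  num_solutions C S n =
    (num_solutions (c :: C) S n + num_solutions C (c :: S) n)%N.
Proof.
rewrite /num_solutions.
rewrite -(cardID [pred x : {ffun T -> 'I_n} | satisfies (fun t => (x t)%:Z) c]).
rewrite addnC.
congr addn; apply: eq_card => x; rewrite !inE /=; case: satisfies => //=;
  by rewrite ?andbT ?andbF.
Qed.

(** Induction on [C] for all nonempty [S]: deletion leaves [S] alone or enlarges it, so both terms
    of the difference keep size at most [#|T|]. *)
Lemma num_solutions_mixed_poly M C S : all (bounded_constraint M) C ->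
  all (bounded_constraint M) S -> S != [::] ->
  exists2 p : {poly rat}, (size p <= #|T|)%N &
    forall n, (#|T|.-1 * M <= n)%N -> (num_solutions C S n)%:R = p.[n%:R].
Proof.
elim: C S => [|c C IH] S /=; first by move=> _; exact: num_solutions_eqs_poly.
move=> /andP[cM CM] SM S0; have [p szp pE] := IH _ CM SM S0.
have [|//|r szr rE] := IH (c :: S) CM; first by rewrite /= cM.
exists (p - r) => [|n nM].
  by rewrite (leq_trans (size_polyD _ _)) // size_polyN geq_max szp.
by rewrite hornerD hornerN -pE // -rE // (num_solutions_split c C) natrD addrK.
Qed.

(** Without constraints the count is [n ^ #|T|]. Every term subtracted later has a nonempty [S],
    hence lower degree. *)
Lemma num_solutions_poly M C : all (bounded_constraint M) C ->
  exists2 p : {poly rat}, (size p <= #|T|)%N &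
    forall n, (#|T|.-1 * M <= n)%N ->
      (num_solutions C [::] n)%:R = ('X^#|T| + p).[n%:R].
Proof.
elim: C => [_|c C IH /= /andP[cM CM]].
  exists 0 => [|n _]; first by rewrite size_poly0.
  rewrite addr0 hornerXn /num_solutions -natrX.
  have -> : (n ^ #|T|)%N = #|{ffun T -> 'I_n}| by rewrite card_ffun card_ord.
  by congr (_%:R); apply: eq_card.
have [p szp pE] := IH CM.
have [|//|r szr rE] := @num_solutions_mixed_poly M C [:: c] CM.
  by rewrite /= cM.
exists (p - r) => [|n nM].
  by rewrite (leq_trans (size_polyD _ _)) // size_polyN geq_max szp.
rewrite addrA hornerD hornerN -pE // -rE // (num_solutions_split c C).
by rewrite natrD addrK.
Qed.

End ConstraintGraph.

(** * Moves of a piece as finitely many constraints *)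

(** The maximum bounds its members because the index set is finite: each nonzero row displacement
    has finitely many moves, and displacement 0 occurs only for [lo = 0], where finiteness is
    assumed. *)
Lemma max_displacement_ge (P : fairy_piece) (lo hi k : nat) (mu : int) :
  (lo = 0%N -> finite_set (moves P `&` horizontal_line)) ->
  (lo <= k < hi)%N -> moves P (mu, k%:Z) ->
  (`|mu| <= max_displacement P lo hi)%N.
Proof.
move=> finP khi Pmu.
have finA : finite_set [set mu : int | exists2 k : nat,
    (lo <= k < hi)%N & moves P (mu, k%:Z)].
  apply: (@sub_finite_set _ _
    (\bigcup_(k in `I_hi) [set mu | (lo <= k)%N /\ moves P (mu, k%:Z)])).
    by move=> nu [l /andP[lol lhi] Pnu]; exists l.
  apply: bigcup_finite => [|l _]; first exact: finite_II.
  have [->|l0] := eqVneq l 0%N; last first.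
    have /sub_finite_set : [set mu | (lo <= l)%N /\ moves P (mu, l%:Z)] `<=`
      [set mu | moves P (mu, l%:Z)] by move=> ? [].
    by apply; apply: moves_finite.
  case: lo finP {khi} => [/(_ erefl) finP|lo _]; last first.
    by apply: (@sub_finite_set _ _ set0) => // ? [].
  apply: sub_finite_set (finite_image fst finP) => nu [_ Pnu].
  by exists (nu, 0).
rewrite /max_displacement fsbig_finite //.
apply: (@leq_bigmax_seq _ _ xpredT (fun mu : int => `|mu|%N)) => //.
by rewrite in_fset_set // inE; exists k.
Qed.

Section Pieces.
Variables (m : nat) (q_ : 'I_m -> nat).

Let piece : finType := {j : 'I_m & 'I_(q_ j)}.

(** Ordering the pieces by row, then by label, merges (N1) and (N2) into one condition on ordered
    pairs. *)
Definition precedes (u v : piece) : bool :=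
  (tag u < tag v)%N || (tag u == tag v :> nat) && (tagged u < tagged v)%N.

Lemma nonattackingE (P : fairy_piece) n (x : labelled_config q_ n) :
  nonattacking P x <-> forall u v : piece, precedes u v ->
    ~ moves P ((x v)%:Z - (x u)%:Z, (tag v)%:Z - (tag u)%:Z).
Proof.
split=> [[N1 N2] [i r] [j s] /orP[ij|/andP[/= /eqP/val_inj ij]]|N]; first exact: N1.
  by subst j => rs; rewrite subrr; apply: N2.
split=> [i j r s ij|j r s rs].
  by apply: (N (Tagged _ r) (Tagged _ s)); rewrite /precedes /= ij.
have := N (Tagged _ r) (Tagged _ s); rewrite /precedes /= eqxx rs orbT.
by rewrite subrr; apply.
Qed.

Lemma card_piece : #|piece| = (\sum_(j < m) q_ j)%N.
Proof.
rewrite card_tagged sumnE big_map big_enum /=.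
by apply: eq_bigr => j _; rewrite card_ord.
Qed.

Lemma nonattacking_constraints (P : fairy_piece) (lo : nat) :
  (lo = 0%N -> finite_set (moves P `&` horizontal_line)) ->
  ((0 < lo)%N -> lo = 1%N /\ forall j, (q_ j <= 1)%N) ->
  exists2 C : seq (piece * piece * int),
    all (bounded_constraint (max_displacement P lo m)) C &
    forall n (x : labelled_config q_ n), nonattacking P x <->
      all (fun c => ~~ satisfies (fun u : piece => (x u)%:Z) c) C.
Proof.
move=> lo0 lo1; set M := max_displacement P lo m.
have movesM (u v : piece) d : precedes u v ->
    moves P (d, (tag v)%:Z - (tag u)%:Z) -> (`|d| <= M)%N.
  move=> uv; rewrite subzn; last by move: uv; rewrite /precedes; lia.
  apply: max_displacement_ge => //.
  have := ltn_ord (tag v); move: uv; rewrite /precedes.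
  (* If [lo = 1], no row holds two pieces, so [precedes] forces a row displacement of at least 1. *)
  case: (posnP lo) => [->|]; first by lia.
  move=> /lo1[-> q1]; have := q1 (tag v); have := ltn_ord (tagged v).
  by lia.
(* [D] runs through the [2M + 1] integers from [-M] to [M], which include every displacement that
   can be forbidden. *)
pose D := [seq k%:Z - M%:Z | k <- iota 0 (M + M).+1].
pose C0 := [seq (uv, d) | uv <- enum {: piece * piece}, d <- D].
pose badc (c : piece * piece * int) := precedes c.1.1 c.1.2 &&
  `[< moves P (c.2, (tag c.1.2)%:Z - (tag c.1.1)%:Z) >].
exists [seq c <- C0 | badc c].
  apply/allP => -[[u v] d]; rewrite mem_filter /= => /andP[/andP[uv /asboolP Pd] _].
  rewrite /bounded_constraint /= (movesM _ _ _ uv Pd) andbT.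
  by apply/eqP => vu; move: uv; rewrite vu /precedes !ltnn andbF.
move=> n x; rewrite nonattackingE; split=> [N|/allP N u v uv Pd].
  apply/allP => -[[u v] d]; rewrite mem_filter /= => /andP[/andP[uv /asboolP Pd] _].
  by apply/negP => /eqP /= xd; apply: (N u v uv); rewrite xd.
suff /N : ((u, v), (x v)%:Z - (x u)%:Z) \in [seq c <- C0 | badc c].
  by rewrite /satisfies eqxx.
rewrite mem_filter /badc /= uv asboolT //=.
apply: (allpairs_f pair); first by rewrite mem_enum.
have := movesM _ _ _ uv Pd; move: (_ - _) => d dM.
apply/mapP; exists (absz (d + M%:Z)); last by lia.
by rewrite mem_iota; lia.
Qed.

End Pieces.

(** * Counting configurations and piecewise polynomiality *)

Lemma num_labelled_poly (m : nat) (q_ : 'I_m -> nat) (P : fairy_piece) (lo : nat) :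
  let q := (\sum_(j < m) q_ j)%N in
  (lo = 0%N -> finite_set (moves P `&` horizontal_line)) ->
  ((0 < lo)%N -> lo = 1%N /\ forall j, (q_ j <= 1)%N) ->
  exists2 p : {poly rat}, (size p <= q)%N &
    forall n, (q.-1 * max_displacement P lo m <= n)%N ->
      (num_labelled q_ P n)%:R = ('X^q + p).[n%:R].
Proof.
move=> q lo0 lo1; have [C CM CE] := nonattacking_constraints lo0 lo1.
have [p szp pE] := num_solutions_poly CM; rewrite card_piece -/q in szp pE.
exists p => // n /pE <-; congr (_%:R); apply: eq_card => x; rewrite !inE andbT.
by apply/asboolP/idP; rewrite CE.
Qed.

(* Below the threshold the intervals are singletons: since [d > 0] there,
   adding a constant to [p] keeps its degree and leading coefficient. *)
Lemma piecewise_polynomial_eventually (d N : nat) (c : rat) (f : nat -> rat)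
    (p : {poly rat}) :
  has_degree_lead d c p -> ((0 < N)%N -> (0 < d)%N) ->
  (forall n, (N <= n)%N -> f n = p.[n%:R]) -> piecewise_polynomial d c f.
Proof.
move=> [szp lcp] N_d fE.
pose I (i : 'I_N.+1) : interval nat :=
  if (i < N)%N then `[i : nat, i : nat] else `[N, +oo[.
(* The point [n] lies in exactly the interval of index [minn n N], which gives the partition. *)
have IE n (i : 'I_N.+1) : (n \in I i) = (i == minn n N :> nat).
  rewrite /I; case: ltnP => iN; rewrite in_itv /= ?andbT !leEnat; last first.
    by have := ltn_ord i; lia.
  by lia.
exists N.+1, I; split.
  split.
  - apply/seteqP; split=> // n _.
    have ltn : (minn n N < N.+1)%N by lia.
    by exists (Ordinal ltn) => //=; rewrite IE.
  - apply/trivIsetP => i j _ _ ij; apply/seteqP; split=> // n [] /=.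
    by rewrite !IE => /eqP <- /eqP /val_inj ji; rewrite ji eqxx in ij.
  - by move=> i _; exists (i : nat); rewrite /= IE; have := ltn_ord i; lia.
move=> i; case: (ltnP i N) => iN; last first.
  by exists p => // n; rewrite IE => ?; apply: fE; lia.
have szc : (size ((f i - p.[i%:R])%:P : {poly rat}) < size p)%N.
  by rewrite szp (leq_ltn_trans (size_polyC_leq1 _)) // ltnS N_d //; lia.
exists (p + (f i - p.[i%:R])%:P).
  by split; rewrite ?size_polyDl ?lead_coefDl.
move=> n; rewrite IE => ni; have -> : n = i by lia.
by rewrite hornerD hornerC addrC subrK.
Qed.

Theorem theorem2p1 (m : nat) (m_ge1 : (1 <= m)%N) (P : fairy_piece)
    (q_ : 'I_m -> nat)
    (q_le1 : horizontally_unbounded P -> forall j, (q_ j <= 1)%N) :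
  let q := (\sum_(j < m) q_ j)%N in
  let c : rat := ((\prod_(j < m) (q_ j)`!)%:R)^-1 in
  let lo := if `[< horizontally_unbounded P \/ forall j, (q_ j <= 1)%N >]
            then 1%N else 0%N in
  let M := max_displacement P lo m in
  piecewise_polynomial q c (num_nonattacking q_ P) /\
  exists p : {poly rat},
    [/\ has_degree_lead q c p,
        (exists N : nat, forall n : nat, (N <= n)%N ->
           num_nonattacking q_ P n = p.[n%:R])
      & forall n : nat, (q%:Z - 1) * M%:Z <= n%:Z ->
           num_nonattacking q_ P n = p.[n%:R]].
Proof.
move=> q c lo M; set f := num_nonattacking q_ P.
have [p szp pE] : exists2 p : {poly rat}, (size p <= q)%N &
    forall n, (q.-1 * M <= n)%N -> (num_labelled q_ P n)%:R = ('X^q + p).[n%:R].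
  (* If [lo = 0], the horizontal moves are not the whole line, hence finite; if [lo = 1], every row
     has at most one piece, by [q_le1] or directly. *)
  apply: num_labelled_poly; rewrite /lo; case: asboolP => //.
    by move=> h _; case: (moves_horizontal P) => // hu; case: h; left.
  by move=> h _; split=> //; case: h.
have c0 : c != 0.
  rewrite invr_eq0 pnatr_eq0 -lt0n prodn_gt0 // => j.
  exact: fact_gt0.
have ltp : (size p < size ('X^q : {poly rat}))%N by rewrite size_polyXn.
have cp : has_degree_lead q c (c *: ('X^q + p)).
  rewrite /has_degree_lead size_scale // size_polyDl // size_polyXn; split=> //.
  by rewrite lead_coefZ lead_coefDl // lead_coefXn mulr1.
have fE n : (q.-1 * M <= n)%N -> f n = (c *: ('X^q + p)).[n%:R].
  by move=> nM; rewrite hornerZ -pE // mulrC.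
split.
  (* A positive threshold [q.-1 * M] forces [q > 0]. *)
  by apply: piecewise_polynomial_eventually cp _ fE; case: (q).
exists (c *: ('X^q + p)); split=> //; first by exists (q.-1 * M)%N.
(* For [q = 0] the integer bound is [-M] and the natural one is 0, both met by every [n]; for
   [q > 0] the two bounds agree. *)
move=> n nM; apply: fE; case: (posnP q) nM => [-> //|q0].
by rewrite -predn_int // -PoszM lez_nat.
Qed.
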